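(* Let $\overline{A_0A_1A_2A_3}$ be a tetrahedron in $\mathbb{A}^3$ that is $B$-tri-rectangular at $A_0$, with all $B$-quadrances $Q_{ij}$ ($0\le i<j\le3$) nonzero. Then its $B$-solid spreads satisfy $$(1-\mathcal{S}_1-\mathcal{S}_2-\mathcal{S}_3)^2=4\mathcal{S}_1\mathcal{S}_2\mathcal{S}_3.$$
   Context: Let $\mathbb{F}$ be a field of characteristic not $2$, $\mathbb{V}^3=\mathbb{F}^3$ the space of row vectors, and $\mathbb{A}^3$ the three-dimensional affine space over $\mathbb{F}$ with associated vector space $\mathbb{V}^3$; $\overrightarrow{XY}=Y-X$ for points $X,Y$. Let $B$ be a symmetric invertible $3\times3$ matrix over $\mathbb{F}$. Define $v\cdot_B w=vBw^T$, $Q_B(v)=v\cdot_B v$, $v\times_B w=(v\times w)\,\mathrm{adj}\,B$ where $\times$ is the usual cross product and $\mathrm{adj}\,B=(\det B)B^{-1}$, and $[v_1,v_2,v_3]_B=v_1\cdot_B(v_2\times_B v_3)$. A tetrahedron $\overline{A_0A_1A_2A_3}$ is a collection of four points of $\mathbb{A}^3$. Its $B$-quadrances are $Q_{ij}=Q_B(\overrightarrow{A_iA_j})$ (symmetric in $i,j$). It is $B$-tri-rectangular at $A_0$ if the vectors $v_i=\overrightarrow{A_0A_i}$ ($i=1,2,3$) are mutually $B$-perpendicular: $v_1\cdot_B v_2=v_1\cdot_B v_3=v_2\cdot_B v_3=0$. The $B$-solid spread of three concurrent lines with direction vectors $u_1,u_2,u_3$ satisfying $Q_B(u_i)\ne0$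 is $\frac{([u_1,u_2,u_3]_B)^2}{(\det B)Q_B(u_1)Q_B(u_2)Q_B(u_3)}$. For $\{i,j,k,l\}=\{0,1,2,3\}$, $\mathcal{S}_i$ is the $B$-solid spread of the lines $A_iA_j$, $A_iA_k$, $A_iA_l$. *)

(* Defs.v *)
(* MathComp *)
From mathcomp Require Import all_boot all_order all_algebra.

Set Implicit Arguments.
Unset Strict Implicit.
Unset Printing Implicit Defensive.

Import GRing.Theory.
Local Open Scope ring_scope.

Definition bdot (F : fieldType) (B : 'M[F]_3) (v w : 'rV[F]_3) : F :=
  (v *m B *m w^T) 0 0.

Definition bquad (F : fieldType) (B : 'M[F]_3) (v : 'rV[F]_3) : F := bdot B v v.

(* Indices live in 'I_3 = Z/3, so k + 1 and k + 2 are taken modulo 3 and the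
   components are v1 w2 - v2 w1, v2 w0 - v0 w2, v0 w1 - v1 w0. *)
Definition cross (F : fieldType) (v w : 'rV[F]_3) : 'rV[F]_3 :=
  \row_(k < 3) (v 0 (k + 1) * w 0 (k + 2) - v 0 (k + 2) * w 0 (k + 1)).

(* For invertible B, \adj B is (\det B) B^-1: see adj_invmx. *)
Definition bcross (F : fieldType) (B : 'M[F]_3) (v w : 'rV[F]_3) : 'rV[F]_3 :=
  cross v w *m \adj B.

Lemma adj_invmx (F : fieldType) (B : 'M[F]_3) :
  B \in unitmx -> \adj B = \det B *: invmx B.
Proof.
by move=> uB; rewrite -[LHS](mulKmx uB) mul_mx_adj mul_mx_scalar.
Qed.

Definition btriple (F : fieldType) (B : 'M[F]_3) (v1 v2 v3 : 'rV[F]_3) : F :=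
  bdot B v1 (bcross B v2 v3).

(* For lines with direction vectors u1, u2, u3; meaningful only when the three
   bquad B ui are nonzero. *)
Definition bsolid_spread (F : fieldType) (B : 'M[F]_3) (u1 u2 u3 : 'rV[F]_3) : F :=
  btriple B u1 u2 u3 ^+ 2 /
    (\det B * bquad B u1 * bquad B u2 * bquad B u3).

(* Points of the affine space are given by their coordinates, and a tetrahedron
   is any family A : 'I_4 -> 'rV_3 of four points. *)
Definition vec (F : fieldType) (X Y : 'rV[F]_3) : 'rV[F]_3 := Y - X.

Definition quadrance (F : fieldType) (B : 'M[F]_3) (A : 'I_4 -> 'rV[F]_3)
    (i j : 'I_4) : F :=
  bquad B (vec (A i) (A j)).

Definition trirectangular0 (F : fieldType) (B : 'M[F]_3)
    (A : 'I_4 -> 'rV[F]_3) : Prop :=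
  [/\ bdot B (vec (A 0) (A 1)) (vec (A 0) (A 2)) = 0,
      bdot B (vec (A 0) (A 1)) (vec (A 0) (A 3)) = 0
    & bdot B (vec (A 0) (A 2)) (vec (A 0) (A 3)) = 0].

(* lift i enumerates increasingly the three indices other than i; their order
   is immaterial, since permuting u1, u2, u3 only changes the sign of
   btriple B u1 u2 u3. *)
Definition solid_spread_at (F : fieldType) (B : 'M[F]_3)
    (A : 'I_4 -> 'rV[F]_3) (i : 'I_4) : F :=
  bsolid_spread B (vec (A i) (A (lift i (0 : 'I_3))))
                  (vec (A i) (A (lift i (1 : 'I_3))))
                  (vec (A i) (A (lift i (2 : 'I_3)))).

(* Main.v *)
Require Import Defs.
From mathcomp Require Import all_boot all_order all_algebra ring.

Set Implicit Arguments.
Unset Strict Implicit.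
Unset Printing Implicit Defensive.

Import GRing.Theory.
Local Open Scope ring_scope.

(** Everything reduces to the inner products of the three edges at [A 0].  The
   squared triple product is a Gram determinant: up to the factor [\det B] it
   is [\det (U *m B *m U^T)], where the rows of [U] are the three vectors
   ([btriple_sqr]).  A solid spread therefore depends only on the mutual
   [B]-products of its direction vectors.

   Let [x], [y], [z] be the three perpendicular edges at [A 0], with quadrances
   [a], [b], [c].  At the far end of [x] the edges are [- x], [y - x], [z - x].
   Perpendicularity gives them quadrances [a], [a + b], [a + c] and Gram
   determinant [a * b * c], so that the solid spread there is
   [b * c / ((a + b) * (a + c))] ([bsolid_spread_corner]).  The other two
   vertices follow by exchanging the roles of the edges.  With
   [D := (a + b) * (b + c) * (c + a)], the identity
   [D - b * c * (b + c) - c * a * (c + a) - a * b * (a + b) = 2 * a * b * c]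
   shows that [1 - S1 - S2 - S3 = 2 * a * b * c / D], whereas
   [S1 * S2 * S3 = (a * b * c / D) ^+ 2]. *)

Lemma det_mx33 (R : comNzRingType) (M : 'M[R]_3) :
  \det M = M 0 0 * (M 1 1 * M 2 2 - M 1 2 * M 2 1)
         - M 0 1 * (M 1 0 * M 2 2 - M 1 2 * M 2 0)
         + M 0 2 * (M 1 0 * M 2 1 - M 1 1 * M 2 0).
Proof.
(* Indexing by [nat] makes the different ordinal forms of an index convertible,
   so that [ring] identifies the entries. *)
pose f (i j : nat) := M (inord i) (inord j).
have Mf i j : M i j = f i j by rewrite /f !inord_val.
rewrite (expand_det_row _ 0) !big_ord_recl big_ord0 /cofactor.
rewrite !(expand_det_row _ 0) !big_ord_recl !big_ord0 /cofactor.
rewrite !det_mx11 !mxE !Mf /= /bump /=; ring.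
Qed.

Section BilinearGeometry.
Variables (F : fieldType) (B : 'M[F]_3).
Implicit Types u v w x y z : 'rV[F]_3.

Lemma bdotDl u v w : bdot B (u + v) w = bdot B u w + bdot B v w.
Proof. by rewrite /bdot !mulmxDl mxE. Qed.

Lemma bdotNl u w : bdot B (- u) w = - bdot B u w.
Proof. by rewrite /bdot !mulNmx mxE. Qed.

Hypothesis symB : B^T = B.

Lemma bdotC u v : bdot B u v = bdot B v u.
Proof.
rewrite /bdot; transitivity ((u *m B *m v^T)^T 0 0); first by rewrite [RHS]mxE.
by rewrite !trmx_mul trmxK symB mulmxA.
Qed.

Lemma bdotDr u v w : bdot B w (u + v) = bdot B w u + bdot B w v.
Proof. by rewrite bdotC bdotDl !(bdotC _ w). Qed.

Lemma bdotNr u w : bdot B w (- u) = - bdot B w u.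
Proof. by rewrite bdotC bdotNl bdotC. Qed.

Definition rows3 u v w : 'M[F]_3 :=
  \matrix_i (if i == 0 then u else if i == 1 then v else w).

(** As [B *m \adj B] is the scalar matrix [\det B], the adjugate in [bcross]
    absorbs the [B] of the inner product and leaves the ordinary triple
    product. *)
Lemma btriple_det u v w : btriple B u v w = \det B * \det (rows3 u v w).
Proof.
rewrite /btriple /bdot /bcross trmx_mul -mulmxA (mulmxA B) -{1}symB -trmx_mul.
rewrite mul_adj_mx tr_scalar_mx mul_scalar_mx -scalemxAr mxE; congr (_ * _).
rewrite det_mx33 !mxE !big_ord_recl big_ord0 !mxE /=.
(* Coordinates are indexed by [nat] for [ring], as in [det_mx33]. *)
pose coord (t : 'rV[F]_3) (j : nat) : F := t 0 (inord j).
have coordE (t : 'rV[F]_3) (i : 'I_3) : t 0 i = coord t i.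
  by rewrite /coord inord_val.
rewrite !coordE /= /bump /=; ring.
Qed.

Lemma gram_entry (U : 'M[F]_3) i j :
  (U *m B *m U^T) i j = bdot B (row i U) (row j U).
Proof.
by rewrite /bdot -row_mul !mxE; apply: eq_bigr => k _; rewrite !mxE.
Qed.

(** The bracket is the Gram determinant of [u], [v], [w] expanded along its
    first row. *)
Lemma btriple_sqr u v w :
  btriple B u v w ^+ 2 =
    \det B * (bquad B u * (bquad B v * bquad B w - bdot B v w ^+ 2)
            - bdot B u v * (bdot B u v * bquad B w - bdot B v w * bdot B u w)
            + bdot B u w * (bdot B u v * bdot B v w - bquad B v * bdot B u w)).
Proof.
set U := rows3 u v w.
have -> : btriple B u v w ^+ 2 = \det B * \det (U *m B *m U^T).
  by rewrite btriple_det !det_mulmx det_tr; ring.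
rewrite [X in _ * X]det_mx33 !gram_entry !rowK /= /bquad.
by rewrite (bdotC v u) (bdotC w u) (bdotC w v); ring.
Qed.

Lemma bquadB_orth x y :
  bdot B x y = 0 -> bquad B (y - x) = bquad B x + bquad B y.
Proof.
move=> xy; rewrite /bquad bdotDl !bdotDr !bdotNl !bdotNr (bdotC y) xy; ring.
Qed.

(** Seen from the far end of [x], the edges have Gram matrix with rows
    [(a, a, a)], [(a, a + b, a)], [(a, a, a + c)], where [a], [b], [c] are the
    quadrances of [x], [y], [z].  Subtracting the first row from the others
    shows that its determinant is [a * b * c]. *)
Lemma bsolid_spread_corner x y z :
    bdot B x y = 0 -> bdot B x z = 0 -> bdot B y z = 0 ->
    B \in unitmx -> bquad B x != 0 ->
  bsolid_spread B (- x) (y - x) (z - x) =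
    bquad B y * bquad B z /
      ((bquad B x + bquad B y) * (bquad B x + bquad B z)).
Proof.
move=> xy xz yz; rewrite unitmxE unitfE => dB0 a0.
have qN : bquad B (- x) = bquad B x by rewrite /bquad bdotNl bdotNr opprK.
have num : btriple B (- x) (y - x) (z - x) ^+ 2 =
    (\det B * bquad B x) * (bquad B y * bquad B z).
  rewrite btriple_sqr !bquadB_orth // qN.
  rewrite !(bdotDl, bdotDr, bdotNl, bdotNr) (bdotC y x) xy xz yz /bquad; ring.
rewrite /bsolid_spread num !bquadB_orth // qN -(mulrA _ (_ + _)).
by rewrite -[LHS]mulf_div divff ?mul1r ?mulf_neq0.
Qed.

End BilinearGeometry.

Theorem theorem27 (F : fieldType) (char_neq2 : 2%N \notin [pchar F])
    (B : 'M[F]_3) (symB : B^T = B) (invB : B \in unitmx)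
    (A : 'I_4 -> 'rV[F]_3) (triA : trirectangular0 B A)
    (quadA : forall i j : 'I_4, (i < j)%N -> quadrance B A i j != 0) :
  (1 - solid_spread_at B A 1 - solid_spread_at B A 2 - solid_spread_at B A 3) ^+ 2
  = 4 * solid_spread_at B A 1 * solid_spread_at B A 2 * solid_spread_at B A 3.
Proof.
case: triA.
set x := vec (A 0) (A 1); set y := vec (A 0) (A 2); set z := vec (A 0) (A 3).
move=> xy xz yz.
have edge i j : vec (A i) (A j) = vec (A 0) (A j) - vec (A 0) (A i).
  by rewrite /vec opprB addrA subrK.
have edge0 i : vec (A i) (A 0) = - vec (A 0) (A i) by rewrite /vec opprB.
have corner (i j k : 'I_4) : lift i (0 : 'I_3) = 0 -> lift i (1 : 'I_3) = j ->
    lift i (2 : 'I_3) = k ->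
  let e := vec (A 0) in solid_spread_at B A i =
    bsolid_spread B (- e (A i)) (e (A j) - e (A i)) (e (A k) - e (A i)).
  by rewrite /solid_spread_at => -> -> ->; rewrite edge0 !(edge i).
have corner1 : solid_spread_at B A 1 = bsolid_spread B (- x) (y - x) (z - x).
  by apply: corner; apply: val_inj.
have corner2 : solid_spread_at B A 2 = bsolid_spread B (- y) (x - y) (z - y).
  by apply: corner; apply: val_inj.
have corner3 : solid_spread_at B A 3 = bsolid_spread B (- z) (x - z) (y - z).
  by apply: corner; apply: val_inj.
have yx : bdot B y x = 0 by rewrite bdotC.
have zx : bdot B z x = 0 by rewrite bdotC.
have zy : bdot B z y = 0 by rewrite bdotC.
have a0 : bquad B x != 0 by apply: quadA.
have b0 : bquad B y != 0 by apply: quadA.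
have c0 : bquad B z != 0 by apply: quadA.
have ab0 : bquad B x + bquad B y != 0.
  by rewrite -bquadB_orth // /x /y -edge; apply: quadA.
have ac0 : bquad B x + bquad B z != 0.
  by rewrite -bquadB_orth // /x /z -edge; apply: quadA.
have bc0 : bquad B y + bquad B z != 0.
  by rewrite -bquadB_orth // /y /z -edge; apply: quadA.
rewrite corner1 corner2 corner3 !bsolid_spread_corner //.
(* Each pair of quadrances is put in the same order in all three spreads, to
   match [ab0], [ac0] and [bc0]. *)
rewrite (addrC (bquad B y) (bquad B x)) !(addrC (bquad B z)).
by field; rewrite ?ab0 ?ac0 ?bc0.
Qed.
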